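(* Let $d\ge 3$, $n\in\mathbb{N}_0$, $\lambda=\frac{d-2}{2}$ and $N=\dim\mathcal{H}_n^d$. If $\{x_1,\ldots,x_N\}\subset\mathbb{S}^{d-1}$ is a fundamental system of degree $n$ on the sphere, i.e. $\det[C_n^\lambda(\langle x_i,x_j\rangle)]_{i,j=1}^N>0$, then the functions $x\mapsto C_n^\lambda(\langle x,x_i\rangle)$, $x\in\mathbb{S}^{d-1}$, $i=1,2,\ldots,N$, form a basis of $\mathcal{H}_n^d|_{\mathbb{S}^{d-1}}$.
   Context: $\mathbb{S}^{d-1}$ is the unit sphere in $\mathbb{R}^d$ and $\langle\cdot,\cdot\rangle$ is the standard inner product. $\mathcal{H}_n^d$ is the real vector space of real polynomials on $\mathbb{R}^d$ that are homogeneous of degree $n$ and harmonic, and $\mathcal{H}_n^d|_{\mathbb{S}^{d-1}}$ is the space of restrictions of its elements to $\mathbb{S}^{d-1}$. For $\lambda>0$ the Gegenbauer polynomial is $$C_n^\lambda(t)=\frac{(\lambda)_n2^n}{n!}\sum_{0\le j\le n/2}\frac{(-\frac n2)_j(\frac{1-n}{2})_j}{j!\,(1-n-\lambda)_j}\,t^{n-2j},$$ where $(a)_k=a(a+1)\cdots(a+k-1)$, $(a)_0=1$. *)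

(* Defs.v *)
From HB Require Import structures.
From mathcomp Require Import all_boot all_order all_algebra.
From mathcomp Require Import mpoly.
From mathcomp Require Import classical_sets functions reals.

Set Implicit Arguments.
Unset Strict Implicit.
Unset Printing Implicit Defensive.

Import Order.TTheory GRing.Theory Num.Theory.
Local Open Scope classical_set_scope.
Local Open Scope ring_scope.

Definition dotp (R : realType) (d : nat) (x y : 'rV[R]_d) : R :=
  \sum_(i < d) x 0 i * y 0 i.

Definition sphere (R : realType) (d : nat) : Type :=
  {x : 'rV[R]_d | dotp x x == 1}.

Definition pochhammer (R : realType) (a : R) (k : nat) : R :=
  \prod_(i < k) (a + i%:R).

Definition gegenbauer (R : realType) (lambda : R) (n : nat) : {poly R} :=
  (pochhammer lambda n * 2 ^+ n / n`!%:R) *: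
    \sum_(j < n./2.+1)
      (pochhammer (- (n%:R / 2)) j * pochhammer ((1 - n%:R) / 2) j
        / (j`!%:R * pochhammer (1 - n%:R - lambda) j)) *: 'X^(n - 2 * j).

Definition laplacian (R : realType) (d : nat) (p : {mpoly R[d]}) : {mpoly R[d]} :=
  \sum_(i < d) p^`M(i)^`M(i).

Lemma mderiv_homog (R : realType) (d n : nat) (i : 'I_d) (p : {mpoly R[d]}) :
  p \is n.-homog -> p^`M(i) \is n.-1.-homog.
Proof.
move=> /dhomogP hp; rewrite [p]mpolyE raddf_sum /= big_seq rpred_sum // => k hk.
rewrite mderivZ mderivX; apply/rpredZ.
have [->|ki] := posnP (k i); first by rewrite scale0r rpred0.
apply/rpredZ; rewrite dhomogX -(hp _ hk) /= -eqSS prednK; last first.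
  by rewrite (leq_trans ki) // mdegE (bigD1 i) //= leq_addr.
by rewrite -addn1 -(mdeg1 i) -mdegD submK // lep1mP -lt0n.
Qed.

Lemma laplacian_homog (R : realType) (d n : nat) (p : {mpoly R[d]}) :
  p \is n.-homog -> laplacian p \is n.-2.-homog.
Proof. by move=> hp; apply/rpred_sum => i _; do 2!apply/mderiv_homog. Qed.

(* For n < 2 the truncated degree n.-2 is 0 and the Laplacian vanishes. *)
Definition dhomog_laplacian (R : realType) (d n : nat) (p : dhomog d R n) :
    dhomog d R n.-2 :=
  DHomog (laplacian_homog (dhomog_is_dhomog p)).

Lemma dhomog_laplacian_is_linear (R : realType) (d n : nat) :
  linear (@dhomog_laplacian R d n).
Proof.
move=> c p q; apply/val_inj; rewrite /= /laplacian scaler_sumr -big_split /=.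
by apply: eq_bigr => i _; rewrite !linearP.
Qed.

HB.instance Definition _ (R : realType) (d n : nat) :=
  GRing.isLinear.Build R (dhomog d R n) (dhomog d R n.-2) _
    (@dhomog_laplacian R d n) (@dhomog_laplacian_is_linear R d n).

(* The ambient dimension is m.+1, since homogeneous polynomials form a vectType
   only in a positive number of variables. *)
Definition harmonics (R : realType) (m n : nat) : {vspace dhomog m.+1 R n} :=
  lker (linfun (@dhomog_laplacian R m.+1 n)).

Lemma mem_harmonics (R : realType) (m n : nat) (p : dhomog m.+1 R n) :
  (p \in harmonics R m n) = (laplacian p == 0).
Proof. by rewrite memv_ker lfunE /= -val_eqE. Qed.

(* The codomain is R^o so that the function space is an lmodType over R. *)
Definition sphere_restriction (R : realType) (d n : nat) (p : dhomog d R n) :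
    sphere R d -> R^o :=
  fun x => (p : {mpoly R[d]}).@[fun i => val x 0 i].

Definition is_basis (R : realType) (V : lmodType R) (W : set V) (N : nat)
    (b : 'I_N -> V) : Prop :=
  [/\ forall i, W (b i),
      forall c : 'I_N -> R, \sum_(i < N) c i *: b i = 0 -> forall i, c i = 0
    & forall v, W v -> exists c : 'I_N -> R, v = \sum_(i < N) c i *: b i].

Definition fundamental_system (R : realType) (lambda : R) (d n N : nat)
    (x : 'I_N -> sphere R d) : Prop :=
  0 < \det (\matrix_(i, j) (gegenbauer lambda n).[dotp (val (x i)) (val (x j))]).

(* Main.v *)
(* The zonal polynomials Z_i(y) = |y|^n C_n^lambda(<y / |y|, x_i>) are
   homogeneous and harmonic: Delta(<y,e>^a |y|^(2b)) is a combination of two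
   monomials of the same shape, and the sum over j telescopes. Evaluating a
   vanishing combination of the Z_i at the points x_j gives a vector in the
   kernel of the invertible Gram matrix, so the Z_i are free; there are as many
   of them as the dimension of the harmonics, hence they span. *)
Require Import Defs.
From HB Require Import structures.
From mathcomp Require Import all_boot all_order all_algebra.
From mathcomp Require Import mpoly.
From mathcomp Require Import classical_sets functions reals.
From mathcomp Require Import boolp ring lra.

Set Implicit Arguments.
Unset Strict Implicit.
Unset Printing Implicit Defensive.

Import Order.TTheory GRing.Theory Num.Theory.
Local Open Scope classical_set_scope.
Local Open Scope ring_scope.

Lemma mderiv_exp (R : comNzRingType) (d k : nat) (i : 'I_d) (p : {mpoly R[d]}) :
  (p ^+ k)^`M(i) = p ^+ k.-1 * p^`M(i) *+ k.
Proof.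
elim: k => [|k IHk]; first by rewrite expr0 mderivC mulr0n.
rewrite exprS mderivM IHk /= mulrC mulrS; congr (_ + _).
by rewrite mulrnAr; case: k {IHk} => [|k] //; rewrite mulrA -exprS.
Qed.

Lemma laplacianM (R : realType) (d : nat) (p q : {mpoly R[d]}) :
  laplacian (p * q) =
    laplacian p * q + (\sum_i p^`M(i) * q^`M(i)) *+ 2 + p * laplacian q.
Proof.
rewrite /laplacian mulr_suml mulr_sumr -sumrMnl -!big_split /=.
by apply: eq_bigr => i _; rewrite mderivM mderivD !mderivM; ring.
Qed.

Lemma laplacian_exp (R : realType) (d k : nat) (p : {mpoly R[d]}) :
  laplacian (p ^+ k) =
    p ^+ k.-1 * laplacian p *+ k
    + p ^+ k.-2 * (\sum_i p^`M(i) ^+ 2) *+ (k * k.-1).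
Proof.
rewrite /laplacian !mulr_sumr -!sumrMnl -big_split /=; apply: eq_bigr => i _.
rewrite mderiv_exp mderivMn mderivM mderiv_exp mulrnDl addrC; congr (_ + _).
by rewrite -mulrnAl -mulrA -expr2 mulrnAl -mulrnA mulnC.
Qed.

Lemma laplacianZ (R : realType) (d : nat) (c : R) (p : {mpoly R[d]}) :
  laplacian (c *: p) = c *: laplacian p.
Proof. by rewrite scaler_sumr; apply: eq_bigr => i _; rewrite !mderivZ. Qed.

Lemma laplacian_sum (R : realType) (d : nat) (I : Type) (r : seq I)
    (F : I -> {mpoly R[d]}) :
  laplacian (\sum_(j <- r) F j) = \sum_(j <- r) laplacian (F j).
Proof.
apply: (big_morph (@laplacian R d)) => [p q|].
  by rewrite -big_split; apply: eq_bigr => i _ /=; rewrite !mderivD.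
by apply: big1 => i _; rewrite !mderiv0.
Qed.

Definition linform (R : realType) (d : nat) (e : 'rV[R]_d) : {mpoly R[d]} :=
  \sum_(i < d) e 0 i *: 'X_i.

Definition sqnorm (R : realType) (d : nat) : {mpoly R[d]} :=
  \sum_(i < d) 'X_i ^+ 2.

Lemma mderivXU (R : realType) (d : nat) (i j : 'I_d) :
  ('X_j : {mpoly R[d]})^`M(i) = (i == j)%:R.
Proof.
rewrite mderivX mnm1E eq_sym; case: eqP => [->|_]; last by rewrite scale0r.
rewrite scale1r -mpolyX0; congr 'X_[_].
by apply/mnmP => k; rewrite !mnmE subnn.
Qed.

Lemma mderiv_linform (R : realType) (d : nat) (e : 'rV[R]_d) (i : 'I_d) :
  (linform e)^`M(i) = (e 0 i)%:MP.
Proof.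
rewrite /linform raddf_sum /= (bigD1 i) //= big1 ?addr0 => [|j ji].
  by rewrite mderivZ mderivXU eqxx -mul_mpolyC mulr1.
by rewrite mderivZ mderivXU eq_sym (negPf ji) scaler0.
Qed.

Lemma mderiv_sqnorm (R : realType) (d : nat) (i : 'I_d) :
  (sqnorm R d)^`M(i) = 'X_i *+ 2.
Proof.
rewrite /sqnorm raddf_sum /= (bigD1 i) //= big1 ?addr0 => [|j ji].
  by rewrite mderiv_exp mderivXU eqxx mulr1.
by rewrite mderiv_exp mderivXU eq_sym (negPf ji) mulr0 mul0rn.
Qed.

Lemma laplacian_linform (R : realType) (d : nat) (e : 'rV[R]_d) :
  laplacian (linform e) = 0.
Proof. by apply: big1 => i _; rewrite mderiv_linform mderivC. Qed.

Lemma laplacian_sqnorm (R : realType) (d : nat) :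
  laplacian (sqnorm R d) = (2 * d)%:R.
Proof.
rewrite /laplacian (eq_bigr (fun=> 2%:R)) => [|i _].
  by rewrite sumr_const card_ord -mulrnA.
by rewrite mderiv_sqnorm mderivMn mderivXU eqxx.
Qed.

(* The truncated exponents are harmless: each comes with a vanishing factor. *)
Lemma laplacian_zonal_monomial (R : realType) (d a b : nat) (e : 'rV[R]_d) :
  dotp e e = 1 ->
  laplacian (linform e ^+ a * sqnorm R d ^+ b) =
    linform e ^+ a.-2 * sqnorm R d ^+ b *+ (a * a.-1)
    + linform e ^+ a * sqnorm R d ^+ b.-1
      *+ (b * (4 * a + 2 * d + 4 * b.-1)).
Proof.
move=> e1; rewrite laplacianM !laplacian_exp laplacian_linform laplacian_sqnorm.
have -> : \sum_i (linform e)^`M(i) ^+ 2 = 1.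
  rewrite -mpolyC1 -e1 /dotp raddf_sum /=; apply: eq_bigr => i _.
  by rewrite mderiv_linform -expr2 rmorphXn.
have -> : \sum_i (sqnorm R d)^`M(i) ^+ 2 = sqnorm R d *+ 4.
  rewrite /sqnorm -sumrMnl; apply: eq_bigr => i _.
  by rewrite mderiv_sqnorm; ring.
(* The gradients of [linform e] and [sqnorm] are e and 2y, with inner product 2<y,e>; this factor
   restores the power of [linform e] lost by differentiation. *)
have -> : \sum_i (linform e ^+ a)^`M(i) * (sqnorm R d ^+ b)^`M(i) =
    linform e ^+ a * sqnorm R d ^+ b.-1 *+ (2 * a * b).
  under eq_bigr => i _.
    rewrite !mderiv_exp mderiv_linform mderiv_sqnorm.
    rewrite (_ : _ * _ = (linform e ^+ a.-1 * sqnorm R d ^+ b.-1 *+ (2 * a * b))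
      * ((e 0 i) *: 'X_i)); first over.
    by rewrite -mul_mpolyC; ring.
  rewrite -mulr_sumr -/(linform e); case: a => [|a].
    by rewrite muln0 mul0n !mulr0n mul0r.
  by rewrite exprS /=; ring.
set u := linform e; set r := sqnorm R d.
(* The power [r ^+ b.-2] times [r] is [r ^+ b.-1] only from b = 2 on; for smaller b the coefficient
   b(b-1) vanishes. *)
case: b => [|[|b]]; rewrite ?exprS /=; ring.
Qed.

Lemma dhomog_linform (R : realType) (d : nat) (e : 'rV[R]_d) :
  linform e \is 1.-homog.
Proof.
by apply: rpred_sum => i _; apply/rpredZ; rewrite dhomogX /= mdeg1.
Qed.

Lemma dhomog_sqnorm (R : realType) (d : nat) : sqnorm R d \is 2.-homog.
Proof.
apply: rpred_sum => i _; rewrite -[2%N]mul1n; apply: dhomogMn.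
by rewrite dhomogX /= mdeg1.
Qed.

Definition gegenbauer_coef (R : realType) (lambda : R) (n j : nat) : R :=
  pochhammer (- (n%:R / 2)) j * pochhammer ((1 - n%:R) / 2) j
    / (j`!%:R * pochhammer (1 - n%:R - lambda) j).

Lemma pochhammerS (R : realType) (a : R) (k : nat) :
  pochhammer a k.+1 = pochhammer a k * (a + k%:R).
Proof. by rewrite /pochhammer big_ord_recr. Qed.

(* The factor with 2 * lambda + 2 = d comes from laplacian_zonal_monomial for
   <y,e>^(n - 2(j+1)) |y|^(2(j+1)). *)
Lemma gegenbauer_coefS (R : realType) (lambda : R) (n j : nat) :
  0 < lambda -> (j < n./2)%N ->
  gegenbauer_coef lambda n j * ((n - 2 * j) * (n - 2 * j).-1)%:R =
  - gegenbauer_coef lambda n j.+1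
    * (j.+1%:R * (4 * (n - 2 * j.+1)%:R + 2 * (2 * lambda + 2) + 4 * j%:R)).
Proof.
move=> l0 jn; have jn2 : (2 * j.+1 <= n)%N.
  by rewrite mul2n -geq_half_double.
(* Writing n = k + 2(j+1) removes the truncated subtractions before passing to the field. *)
have [k nk] : {k | n = k + 2 * j.+1}%N.
  by exists (n - 2 * j.+1)%N; rewrite subnK.
have -> : (n - 2 * j.+1 = k)%N by rewrite nk addnK.
have -> : (n - 2 * j = k.+2)%N by rewrite nk mulnS addnA addnK addn2.
rewrite /gegenbauer_coef !pochhammerS factS /=.
(* Since n is at least 2j + 2, the sum 1 - n + i is negative, and subtracting a positive [lambda]
   keeps it so: no denominator vanishes. *)
have neq i : (i <= j)%N -> 1 - n%:R - lambda + i%:R != 0.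
  move=> ij; rewrite lt_eqF // nk natrD natrM mulrSr.
  have : i%:R <= j%:R :> R by rewrite ler_nat.
  have : 0 <= k%:R :> R by rewrite ler0n.
  have : 0 <= j%:R :> R by rewrite ler0n.
  lra.
have P0 : pochhammer (1 - n%:R - lambda) j != 0.
  by apply/prodf_neq0 => i _; apply: neq; exact: ltnW.
have f0 : j`!%:R != 0 :> R by rewrite pnatr_eq0 -lt0n fact_gt0.
have := neq j (leqnn j).
(* Only the last factor of each product matters, so the common parts become opaque variables for
   [field]. *)
move: P0 f0; move: (pochhammer (1 - _ - _) j) (pochhammer (- _) j).
move: (pochhammer ((1 - _) / _) j) (j`!) => Q f S P.
rewrite nk natrD !natrM => S0 f0 D0; field.
by rewrite !nat1r S0 f0 D0 pnatr_eq0.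
Qed.

(** Homogenising term by term, with t^(n-2j) replaced by <y,e>^(n-2j) |y|^(2j), gives a polynomial
    without dividing by |y|. *)
Definition zonal (R : realType) (d n : nat) (lambda : R) (e : 'rV[R]_d) :
    {mpoly R[d]} :=
  (pochhammer lambda n * 2 ^+ n / n`!%:R) *:
    \sum_(j < n./2.+1) gegenbauer_coef lambda n j *:
      (linform e ^+ (n - 2 * j) * sqnorm R d ^+ j).

Lemma dhomog_zonal (R : realType) (d n : nat) (lambda : R) (e : 'rV[R]_d) :
  zonal n lambda e \is n.-homog.
Proof.
apply/rpredZ/rpred_sum => j _; apply/rpredZ.
have jn : (2 * j <= n)%N by rewrite mul2n -geq_half_double -ltnS.
have := dhomogM (dhomogMn (n - 2 * j) (dhomog_linform e))
  (dhomogMn j (dhomog_sqnorm R d)).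
by rewrite mul1n subnK.
Qed.

Lemma laplacian_zonal (R : realType) (d n : nat) (lambda : R) (e : 'rV[R]_d) :
  0 < lambda -> lambda = (d%:R - 2) / 2 -> dotp e e = 1 ->
  laplacian (zonal n lambda e) = 0.
Proof.
move=> l0 ld e1; rewrite laplacianZ laplacian_sum.
under eq_bigr do rewrite laplacianZ laplacian_zonal_monomial // scalerDr.
(* The sums are shifted by one against each other: the first part of term j meets the second part of
   term j+1. The two unpaired ends vanish, one because its power of [sqnorm] is 0, the other because
   its power of [linform e] is 0 or 1. *)
rewrite big_split /= big_ord_recr big_ord_recl /=.
rewrite mul0n mulr0n scaler0 add0r.
have -> : ((n - 2 * n./2) * (n - 2 * n./2).-1 = 0)%N.
  by rewrite mul2n -{1 3}(odd_double_half n) addnK; case: (odd n).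
rewrite mulr0n scaler0 addr0 -big_split /= big1 ?scaler0 // => j _.
rewrite /bump leq0n add1n -!scaler_nat !scalerA gegenbauer_coefS //.
rewrite (_ : (n - 2 * j).-2 = n - 2 * j.+1)%N; last first.
  by rewrite mulnS addnC subnDA subn2.
rewrite -scalerDl [X in X *: _](_ : _ = 0) ?scale0r //.
by rewrite ld add0n; move: (n - _)%N => k; field.
Qed.

(** On the unit sphere every power of [sqnorm] evaluates to 1, which undoes the homogenisation. *)
Lemma meval_zonal (R : realType) (d n : nat) (lambda : R) (e y : 'rV[R]_d) :
  dotp y y = 1 ->
  (zonal n lambda e).@[fun i => y 0 i] = (gegenbauer lambda n).[dotp y e].
Proof.
move=> y1; rewrite mevalZ hornerZ raddf_sum horner_sum /=; congr (_ * _).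
apply: eq_bigr => j _; rewrite mevalZ hornerZ hornerXn mevalM !rmorphXn /=.
have -> : (linform e).@[fun i => y 0 i] = dotp y e.
  rewrite raddf_sum; apply: eq_bigr => i _ /=.
  by rewrite mevalZ mevalXU mulrC.
have -> : (sqnorm R d).@[fun i => y 0 i] = 1.
  rewrite raddf_sum -y1; apply: eq_bigr => i _ /=.
  by rewrite rmorphXn /= mevalXU.
by rewrite expr1n mulr1.
Qed.

Theorem theorem3p3 (R : realType) (m n N : nat) (lambda : R)
    (x : 'I_N -> sphere R m.+1) :
  (3 <= m.+1)%N ->
  lambda = (m.+1%:R - 2) / 2 ->
  N = \dim (harmonics R m n) ->
  fundamental_system lambda n x ->
  is_basis (@sphere_restriction R m.+1 n @` [set` harmonics R m n])
    (fun i (y : sphere R m.+1) =>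
       (gegenbauer lambda n).[dotp (val y) (val (x i))]).
Proof.
move=> m3 ld Nd fs.
have l0 : 0 < lambda.
  have : 3%:R <= m.+1%:R :> R by rewrite ler_nat.
  by rewrite ld; lra.
have e1 (y : sphere R m.+1) : dotp (val y) (val y) = 1 by apply/eqP/(valP y).
pose b i := DHomog (dhomog_zonal n lambda (val (x i))).
have res i : sphere_restriction (b i) =
    (fun y => (gegenbauer lambda n).[dotp (val y) (val (x i))]).
  by apply/funext => y; exact: meval_zonal (e1 y).
have res_sum c : sphere_restriction (\sum_i c i *: b i) =
    \sum_i c i *: (fun y : sphere R m.+1 =>
      (gegenbauer lambda n).[dotp (val y) (val (x i))] : R^o).
  apply/funext => y; rewrite /sphere_restriction raddf_sum raddf_sum /=.
  rewrite fct_sumE; apply: eq_bigr => i _.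
  by rewrite mevalZ /= meval_zonal ?e1.
have bH i : b i \in harmonics R m n.
  by rewrite mem_harmonics laplacian_zonal.
(* Independence is proved for the functions on the sphere; it then passes back to the polynomials
   [b i], because a zero polynomial restricts to the zero function. *)
have indep (c : 'I_N -> R) : \sum_i c i *: (fun y : sphere R m.+1 =>
      (gegenbauer lambda n).[dotp (val y) (val (x i))] : R^o) = 0 ->
    forall i, c i = 0.
  move=> c0; move: fs; rewrite /fundamental_system.
  set G := (\matrix_(_, _) _) => fs.
  have uG : G \in unitmx by rewrite unitmxE unitfE gt_eqF.
  (* Entry i of this product is the vanishing combination evaluated at [x i]. *)
  have Gc : G *m (\col_i c i) = 0.
    apply/matrixP => i k; rewrite !mxE.
    have := congr1 (fun f => f (x i)) c0.
    rewrite fct_sumE => /(etrans _); apply.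
    by apply: eq_bigr => j _; rewrite !mxE mulrC.
  move=> i; have := congr1 (mulmx (invmx G)) Gc; rewrite mulKmx // mulmx0.
  by move=> /matrixP/(_ i 0); rewrite !mxE.
have basis_b : basis_of (harmonics R m n) [tuple b i | i < N].
  rewrite basisEfree size_tuple -Nd leqnn andbT; apply/andP; split.
    apply/freeP => c c0; apply: indep; rewrite -res_sum.
    under eq_bigr do rewrite -(nth_mktuple b 0).
    by rewrite c0; apply/funext => y; rewrite /sphere_restriction meval0.
  by apply/span_subvP => _ /mapP[i _ ->].
split=> [i||_ [p /= pH <-]]; [|exact: indep|].
  by exists (b i); [exact: bH|exact: res].
(* The coefficients of a restriction are the coordinates of a harmonic polynomial [p] that it comes
   from. *)
exists (fun i => coord [tuple b i | i < N] i p).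
rewrite -res_sum {1}(coord_basis basis_b pH); congr sphere_restriction.
by apply: eq_bigr => i _; rewrite nth_mktuple.
Qed.
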